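(* Let $R$ be a unital ring with involution $\ast$, let $a\in R$, let $e,f\in R$ be two invertible Hermitian elements, and let $n\geqslant 1$ be a positive integer. The following conditions are equivalent: (i) $a$ is weighted-$\mathrm{EP}$ with respect to $(e,f)$; (ii) there exists a unique idempotent $p\in R$ such that $(ep)^{\ast}=ep$, $(fp)^{\ast}=fp$, $ap=pa=0$ and $a^{n}+p\in R^{-1}$; (iii) there exists an element $s\in R$ such that $(es)^{\ast}=es$, $(fs)^{\ast}=fs$, $as=sa=0$ and $a^{n}+s\in R^{-1}$.
   Context: An involution $\ast$ on a unital ring $R$ is a map $R\to R$ satisfying $(x^{\ast})^{\ast}=x$, $(x+y)^{\ast}=x^{\ast}+y^{\ast}$ and $(xy)^{\ast}=y^{\ast}x^{\ast}$ for all $x,y\in R$. An element $x$ is Hermitian if $x^{\ast}=x$ and idempotent if $x^{2}=x$. $R^{-1}$ denotes the set of invertible elements of $R$. An element $a\in R$ is group invertible if there is $x\in R$ with $axa=a$, $xax=x$ and $ax=xa$; such an $x$ is unique if it exists and is denoted $a^{\#}$. Let $e,f\in R$ be invertible Hermitian elements. An element $a\in R$ is weighted Moore–Penrose invertible with weights $e,f$ if there is $x\in R$ with $axa=a$, $xax=x$, $(eax)^{\ast}=eax$ and $(fxa)^{\ast}=fxa$; such an $x$ is unique if it exists and is denoted $a^{\dagger}_{e,f}$. An element $a\in R$ is weighted-$\mathrm{EP}$ with respect to $(e,f)$ if $a$ is group invertible, $a$ is weighted Moore–Penrose invertible with weights $e,f$, and $a^{\#}=a^{\dagger}_{e,f}$.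 *)

(* Defs.v *)
From HB Require Import structures.
From mathcomp Require Import all_boot all_order all_algebra.

Set Implicit Arguments.
Unset Strict Implicit.
Unset Printing Implicit Defensive.

Import GRing.Theory.
Local Open Scope ring_scope.

(* Rings are taken in [pzRingType], so the zero ring is allowed.  Since
   [GRing.unit] is only available on [unitRingType] (non-trivial rings with
   decidable invertibility), invertibility is stated as the existence of a
   two-sided inverse. *)
Definition is_invertible (R : pzRingType) (x : R) : Prop :=
  exists y : R, x * y = 1 /\ y * x = 1.

Definition is_ring_involution (R : pzRingType) (star : R -> R) : Prop :=
  [/\ involutive star,
      forall x y : R, star (x + y) = star x + star y
    & forall x y : R, star (x * y) = star y * star x].

Definition is_hermitian (R : pzRingType) (star : R -> R) (x : R) : Prop :=
  star x = x.

Definition is_idempotent (R : pzRingType) (x : R) : Prop := x ^+ 2 = x.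

Definition is_group_inverse (R : pzRingType) (a x : R) : Prop :=
  [/\ a * x * a = a, x * a * x = x & a * x = x * a].

Definition is_weighted_MP_inverse (R : pzRingType) (star : R -> R)
    (e f a x : R) : Prop :=
  [/\ a * x * a = a, x * a * x = x,
      is_hermitian star (e * a * x) & is_hermitian star (f * x * a)].

Definition group_invertible (R : pzRingType) (a : R) : Prop :=
  exists x : R, is_group_inverse a x.

Definition weighted_MP_invertible (R : pzRingType) (star : R -> R)
    (e f a : R) : Prop :=
  exists x : R, is_weighted_MP_inverse star e f a x.

Lemma group_inverse_unique (R : pzRingType) (a x y : R) :
  is_group_inverse a x -> is_group_inverse a y -> x = y.
Proof.
move=> [axa xax axC] [aya yay ayC].
have E : a * x = a * y.
  have H1 : a * x * (a * y) = a * y by rewrite mulrA axa.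
  have H2 : x * a * (y * a) = x * a by rewrite -mulrA (mulrA a y a) aya.
  by rewrite -H1 ayC axC H2.
by rewrite -[LHS]xax -axC E ayC -mulrA E mulrA yay.
Qed.

Lemma weighted_MP_inverse_unique (R : pzRingType) (star : R -> R)
    (e f a x y : R) :
  is_ring_involution star ->
  is_invertible e -> is_hermitian star e ->
  is_invertible f -> is_hermitian star f ->
  is_weighted_MP_inverse star e f a x ->
  is_weighted_MP_inverse star e f a y -> x = y.
Proof.
move=> [_ _ starM] [e' [_ e'e]] eH [f' [_ f'f]] fH.
move=> [axa xax eaxH fxaH] [aya yay eayH fyaH].
have starW g u : is_hermitian star g -> is_hermitian star (g * u) ->
    star u * g = g * u.
  by rewrite /is_hermitian => gH guH; rewrite -{1}gH -starM.
rewrite -(mulrA e a x) in eaxH; rewrite -(mulrA e a y) in eayH.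
rewrite -(mulrA f x a) in fxaH; rewrite -(mulrA f y a) in fyaH.
have E1 : a * x = a * y.
  have H1 : a * x * (a * y) = a * y by rewrite mulrA axa.
  have H2 : a * y * (a * x) = a * x by rewrite mulrA aya.
  suff H : e * (a * x) = e * (a * x * (a * y)).
    by rewrite -H1 -[LHS]mul1r -e'e -mulrA H mulrA e'e mul1r.
  rewrite [RHS]mulrA -(starW _ _ eH eaxH) -[RHS]mulrA -(starW _ _ eH eayH).
  by rewrite [RHS]mulrA -starM H2.
have E2 : x * a = y * a.
  have H1 : x * a * (y * a) = x * a by rewrite -mulrA (mulrA a y a) aya.
  have H2 : y * a * (x * a) = y * a by rewrite -mulrA (mulrA a x a) axa.
  suff H : f * (x * a) = f * (y * a * (x * a)).
    by rewrite -H2 -[LHS]mul1r -f'f -mulrA H mulrA f'f mul1r.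
  rewrite [RHS]mulrA -(starW _ _ fH fyaH) -[RHS]mulrA -(starW _ _ fH fxaH).
  by rewrite [RHS]mulrA -starM H1.
by rewrite -[LHS]xax -mulrA E1 mulrA E2 yay.
Qed.

(* The last clause is the equality of the group inverse of [a] and its
   weighted Moore-Penrose inverse; both exist by the first two clauses and are
   unique by the lemmas above. *)
Definition weighted_EP (R : pzRingType) (star : R -> R) (e f a : R) : Prop :=
  [/\ group_invertible a, weighted_MP_invertible star e f a
    & forall x y : R, is_group_inverse a x ->
        is_weighted_MP_inverse star e f a y -> x = y].

(* Main.v *)
Require Import Defs.
From mathcomp Require Import all_boot all_order all_algebra.

Import GRing.Theory.
Local Open Scope ring_scope.

(** If [a] has group inverse [x], then [g = a * x] is an idempotent acting as
    the identity on [a] and [x], and [p = 1 - g] annihilates both of them.  In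
    the Peirce decomposition along [g] and [p] the element [a ^+ n + p] is the
    unit [a ^+ n] of the corner of [g] plus the unit [p] of the corner of [p];
    hence it is invertible, with inverse [x ^+ n + p].  That [x] is also the
    weighted Moore-Penrose inverse says exactly that [e * g] and [f * g], or
    equivalently [e * p] and [f * p], are Hermitian.  This gives existence in
    the second condition; uniqueness needs no involution
    ([annihilating_idempotent_unique]).

    Conversely let [u = a ^+ n + s] be invertible with inverse [v] and
    [a * s = s * a = 0].  Then [a] commutes with [u], hence with [v], and
    [1 = u * v] splits as the sum of the two orthogonal idempotents
    [a ^+ n * v] and [s * v].  The first one fixes [a], so [a] is group
    invertible and its spectral idempotent is [s * v]
    ([corner_group_inverse]).  It remains to pass from [e * s] Hermitian to
    [e * (s * v)] Hermitian: this works because [s * v] is an idempotent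
    generating the same right ideal as [s]
    ([hermitian_mul_idempotent]). *)

Lemma involutionB (R : pzRingType) (star : R -> R) (x y : R) :
  is_ring_involution star -> star (x - y) = star x - star y.
Proof.
by move=> [_ starD _]; rewrite -[x in RHS](subrK y) [in RHS]starD addrK.
Qed.

Lemma hermitian_mul_compl (R : pzRingType) (star : R -> R) (e g : R) :
  is_ring_involution star -> is_hermitian star e ->
  is_hermitian star (e * g) -> is_hermitian star (e * (1 - g)).
Proof.
move=> star_inv e_herm eg_herm.
by rewrite /is_hermitian mulrBr mulr1 involutionB // e_herm eg_herm.
Qed.

(** Since [star s * e = e * s], multiplying [p = s * v] and [s * p = s] by the
    weight yields [star p * e = star v * e * s = star p * e * p].  The last
    expression is visibly Hermitian, hence so is [star p * e], and it equals
    its own star [e * p]. *)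
Lemma hermitian_mul_idempotent (R : pzRingType) (star : R -> R) (e s v : R) :
  is_ring_involution star -> is_hermitian star e ->
  is_hermitian star (e * s) -> s * (s * v) = s ->
  is_hermitian star (e * (s * v)).
Proof.
move=> [starK _ starM] e_herm es_herm; set p := s * v => sp.
have star_s : star s * e = e * s by rewrite -{1}e_herm -starM.
have star_v : star p * e = star v * (e * s) by rewrite starM -mulrA star_s.
have star_p : star p * e = star p * e * p by rewrite star_v -!mulrA sp.
have star_pK : star (star p * e) = e * p by rewrite starM starK e_herm.
clearbody p; have pe_herm : star (star p * e) = star p * e.
  by rewrite {1}star_p !starM starK e_herm mulrA -star_p.
by rewrite /is_hermitian starM e_herm -[RHS]star_pK pe_herm.
Qed.

Lemma group_inverse_expr (R : pzRingType) (a x : R) (m : nat) :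
  is_group_inverse a x -> a ^+ m.+1 * x ^+ m.+1 = a * x.
Proof.
move=> [axa _ axC]; rewrite -exprMn_comm //.
by elim: m => [|m IHm]; rewrite ?expr1 // exprS IHm mulrA axa.
Qed.

(** The inverse is [x ^+ n + (1 - a * x)]: the mixed products vanish and the
    two diagonal ones are the idempotents [a * x] and [1 - a * x]. *)
Lemma group_inverse_spectral_unit (R : pzRingType) (a x : R) (m : nat) :
  is_group_inverse a x -> is_invertible (a ^+ m.+1 + (1 - a * x)).
Proof.
move=> xP; have [axa xax axC] := xP.
have xP' : is_group_inverse x a by split.
set p := 1 - a * x; exists (x ^+ m.+1 + p).
have ap : a * p = 0 by rewrite mulrBr mulr1 axC mulrA axa subrr.
have pa : p * a = 0 by rewrite mulrBl mul1r axa subrr.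
have xp : x * p = 0 by rewrite mulrBr mulr1 mulrA xax subrr.
have px : p * x = 0 by rewrite mulrBl mul1r axC xax subrr.
have pp : p * p = p by rewrite {2}/p mulrBr mulr1 mulrA pa mul0r subr0.
have axp : a * x + p = 1 by rewrite addrC subrK.
clearbody p.
have Xp y : y * p = 0 -> y ^+ m.+1 * p = 0.
  by move=> yp; rewrite exprSr -mulrA yp mulr0.
have pX y : p * y = 0 -> p * y ^+ m.+1 = 0.
  by move=> py; rewrite exprS mulrA py mul0r.
by split; rewrite mulrDl !mulrDr Xp // pX // addr0 add0r pp
  group_inverse_expr // -?axC.
Qed.

(** With [p = 1 - a * x] one has [(p - q) * (a ^+ n + q) = p * q - q], and this
    vanishes because [x * (a * q) = 0]; the unit [a ^+ n + q] cancels. *)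
Lemma annihilating_idempotent_unique (R : pzRingType) (a x q : R) (m : nat) :
  is_group_inverse a x -> is_idempotent q -> a * q = 0 -> q * a = 0 ->
  is_invertible (a ^+ m.+1 + q) -> 1 - a * x = q.
Proof.
move=> [axa _ axC] qq aq qa [v [uv _]]; apply/subr0_eq.
set p := 1 - a * x.
have pa : p * a = 0 by rewrite mulrBl mul1r axa subrr.
have pq : p * q = q by rewrite mulrBl mul1r axC -mulrA aq mulr0 subr0.
have kill : (p - q) * (a ^+ m.+1 + q) = 0.
  rewrite mulrDr exprS mulrA mulrBl pa qa subrr mul0r add0r.
  by rewrite mulrBl pq -expr2 qq subrr.
by rewrite -[LHS]mulr1 -uv mulrA kill mul0r.
Qed.

Lemma inverse_comm (R : pzRingType) (u v b : R) :
  u * v = 1 -> v * u = 1 -> b * u = u * b -> b * v = v * b.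
Proof.
move=> uv vu bu.
by rewrite -[LHS]mul1r -vu -mulrA (mulrA u) -bu -(mulrA b) uv mulr1.
Qed.

(** From [a * u = a ^+ n * a] the idempotent [g = a ^+ n * v] fixes [a].  The
    group inverse has to be corrected to [x = a ^+ n.-1 * v * g], as
    [a ^+ n.-1 * v] itself need not be fixed by [g] when [n = 1]. *)
Lemma corner_group_inverse (R : pzRingType) (a s v : R) (m : nat) :
  a * s = 0 -> s * a = 0 ->
  (a ^+ m.+1 + s) * v = 1 -> v * (a ^+ m.+1 + s) = 1 ->
  exists2 x, is_group_inverse a x & s * v = 1 - a * x /\ s * (s * v) = s.
Proof.
move=> as0 sa0; set u := _ + s => uv vu.
have au : a * u = a ^+ m.+1 * a by rewrite mulrDr as0 addr0 -exprS exprSr.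
have ua : u * a = a ^+ m.+1 * a by rewrite mulrDl sa0 addr0.
have av : a * v = v * a by apply: (inverse_comm R u) => //; rewrite au ua.
have su : s * u = s * s by rewrite mulrDr exprS mulrA sa0 mul0r add0r.
pose g := a ^+ m.+1 * v.
have gE : s * v = 1 - g by rewrite -uv mulrDl addrC addKr.
have aXv k : a ^+ k * v = v * a ^+ k by apply/esym/commrX.
have ga : g * a = a by rewrite /g aXv -mulrA -ua mulrA vu mul1r.
have gg : g * g = g by rewrite {2}/g exprS -mulrA mulrA ga mulrA -exprS.
pose y := a ^+ m * v.
have ay : a * y = g by rewrite /y /g mulrA -exprS.
have ya : y * a = g by rewrite /y /g -mulrA -av mulrA -exprSr.
have yg : y * g = g * y by rewrite -{1}ay mulrA ya.
have axg : a * (y * g) = g by rewrite mulrA ay gg.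
have xag : y * g * a = g by rewrite -mulrA ga ya.
exists (y * g).
  by split; rewrite ?axg ?xag ?ga // yg mulrA gg.
split; first by rewrite axg.
by rewrite mulrA -su -mulrA uv mulr1.
Qed.

Theorem theorem2p9 (R : pzRingType) (star : R -> R)
    (star_inv : is_ring_involution star) (a e f : R)
    (e_inv : is_invertible e) (e_herm : is_hermitian star e)
    (f_inv : is_invertible f) (f_herm : is_hermitian star f)
    (n : nat) (n_ge1 : (1 <= n)%N) :
  [<-> weighted_EP star e f a;
       exists! p : R,
         [/\ is_idempotent p, is_hermitian star (e * p), is_hermitian star (f * p),
             a * p = 0 /\ p * a = 0 & is_invertible (a ^+ n + p)];
       exists s : R,
         [/\ is_hermitian star (e * s), is_hermitian star (f * s),
             a * s = 0, s * a = 0 & is_invertible (a ^+ n + s)]].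
Proof.
case: n n_ge1 => // m _; tfae.
- move=> [[x xP] [y yP] xy]; have x_y := xy _ _ xP yP; rewrite -{y xy}x_y in yP.
  have [_ _ eax_herm fxa_herm] := yP; have [axa xax axC] := xP.
  exists (1 - a * x); split; last first.
    by move=> q [qq _ _ [aq qa] q_unit];
       apply: (annihilating_idempotent_unique R a x q m).
  split.
  + by rewrite /is_idempotent expr2 mulrBr mulr1 mulrA mulrBl mul1r axa subrr
      mul0r subr0.
  + by apply: hermitian_mul_compl; rewrite // mulrA.
  + by apply: hermitian_mul_compl; rewrite // axC mulrA.
  + by rewrite mulrBr mulrBl mulr1 mul1r axa axC mulrA axa subrr.
  + exact: group_inverse_spectral_unit.
- by move=> [p [[_ ep_herm fp_herm [ap pa] p_unit] _]]; exists p; split.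
- move=> [s [es_herm fs_herm as0 sa0 [v [uv vu]]]].
  have [x xP [svE ssv]] := corner_group_inverse R a s v m as0 sa0 uv vu.
  have [axa xax axC] := xP.
  have axE : a * x = 1 - s * v by rewrite svE opprB addrC subrK.
  have yP : is_weighted_MP_inverse star e f a x.
    split=> //; rewrite -mulrA -?axC axE;
    by apply: hermitian_mul_compl => //; apply: hermitian_mul_idempotent.
  split; [by exists x | by exists x |] => x' y' x'P y'P.
  rewrite (group_inverse_unique x'P xP).
  exact: (weighted_MP_inverse_unique star_inv e_inv e_herm f_inv f_herm yP y'P).
Qed.
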